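(* Let $k\in\mathbb{N}$, $\alpha\in(0,1)$ and $c>0$. Let $(\mathcal{H}_n)_{n\in\mathbb{N}}$ be a sequence of $k$-uniform hypergraphs (multiple edges allowed), each with at least one edge, let $(p_n)_{n\in\mathbb{N}}$ be a sequence in $[0,1]$ such that for every $n$ and every $\ell\in[k]$, \[\Delta_\ell(\mathcal{H}_n)\le c\,p_n^{\ell-1}\frac{e(\mathcal{H}_n)}{v(\mathcal{H}_n)},\] and let $(\mathcal{B}_n)_{n\in\mathbb{N}}$ be a sequence with $\mathcal{B}_n\subseteq\mathcal{P}(V(\mathcal{H}_n))$. If $(\mathcal{H}_n)$ is $(\alpha,\mathcal{B})$-stable, then for every $\delta>0$ there exist $\varepsilon>0$ and $C$ such that for all sufficiently large $n$ and every integer $m\ge Cp_nv(\mathcal{H}_n)$, the number of independent sets $I\in\mathcal{I}(\mathcal{H}_n,m)$ such that $|I\setminus B|\ge\delta m$ for every $B\in\mathcal{B}_n$ is at most \[(1-\varepsilon)^m\binom{\alpha v(\mathcal{H}_n)}{m}.\]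
   Context: Edges of hypergraphs are counted with multiplicity; $v(\cdot)$, $e(\cdot)$ denote numbers of vertices and edges, $\mathcal{H}[U]$ is the induced subhypergraph. $\deg_{\mathcal{H}}(T)$ is the number of edges containing $T$, and $\Delta_\ell(\mathcal{H})=\max\{\deg_{\mathcal{H}}(T):|T|=\ell\}$. $\mathcal{I}(\mathcal{H},m)$ is the family of independent sets (vertex sets containing no edge) of size $m$. The sequence $(\mathcal{H}_n)$ is $(\alpha,\mathcal{B})$-stable if for every $\delta>0$ there exist $\varepsilon>0$ and $n_0$ such that for every $n\ge n_0$ and every $U\subseteq V(\mathcal{H}_n)$ with $|U|\ge(\alpha-\varepsilon)v(\mathcal{H}_n)$, either $e(\mathcal{H}_n[U])\ge\varepsilon e(\mathcal{H}_n)$ or $|U\setminus B|\le\delta v(\mathcal{H}_n)$ for some $B\in\mathcal{B}_n$. For real $x\ge0$ and integer $m\ge0$, $\binom{x}{m}=x(x-1)\cdots(x-m+1)/m!$.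
   Formalization: The binomial coefficient in the bound is replaced by its positive part max(0, binom(αv, m)), since for non-integer αv and m > αv+1 the literal coefficient can be negative, making the stated bound on a count false; where it is nonnegative nothing changes. *)

(* Defs.v *)
From HB Require Import structures.
From mathcomp Require Export all_boot all_order all_algebra.
From mathcomp Require Export reals.

Set Implicit Arguments.
Unset Strict Implicit.
Unset Printing Implicit Defensive.

Import Order.TTheory GRing.Theory Num.Theory.

(* Edges form a sequence, so that multiple edges are counted with
   multiplicity; the order of the sequence plays no role below. *)
Record hypergraph := Hypergraph {
  vert : finType;
  edges : seq {set vert}
}.

Definition nverts (H : hypergraph) : nat := #|vert H|.

Definition nedges (H : hypergraph) : nat := size (edges H).

Definition uniform (k : nat) (H : hypergraph) : bool :=
  all (fun A : {set vert H} => #|A| == k) (edges H).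

Definition induced (H : hypergraph) (U : {set vert H}) : hypergraph :=
  @Hypergraph {x : vert H | x \in U}
    [seq [set x | val x \in A] | A : {set vert H} <- edges H & A \subset U].

Definition deg (H : hypergraph) (T : {set vert H}) : nat :=
  count (fun A : {set vert H} => T \subset A) (edges H).

Definition maxdeg (l : nat) (H : hypergraph) : nat :=
  \max_(T : {set vert H} | #|T| == l) deg T.

Definition independent (H : hypergraph) (I : {set vert H}) : bool :=
  all (fun A : {set vert H} => ~~ (A \subset I)) (edges H).

Definition indep_sets (H : hypergraph) (m : nat) : {set {set vert H}} :=
  [set I : {set vert H} | independent I & #|I| == m].

Local Open Scope ring_scope.

Definition stable (R : realType) (alpha : R) (H : nat -> hypergraph)
    (B : forall n, {set {set vert (H n)}}) : Prop :=
  forall delta : R, 0 < delta ->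
  exists (eps : R) (n0 : nat), 0 < eps /\
  forall n, (n0 <= n)%N ->
  forall U : {set vert (H n)},
    (alpha - eps) * (nverts (H n))%:R <= #|U|%:R ->
    eps * (nedges (H n))%:R <= (nedges (induced U))%:R \/
    exists2 A, A \in B n & #|U :\: A|%:R <= delta * (nverts (H n))%:R.

(* Pitfall: for non-integral x and m > x + 1 this takes negative values, so
   that it can bound a cardinality only through its positive part. *)
Definition rbinom (R : realType) (x : R) (m : nat) : R :=
  (\prod_(i < m) (x - i%:R)) / (m`!)%:R.

(* Main.v *)
Require Import Defs.
From mathcomp Require Import all_boot all_order all_algebra.
From mathcomp Require Import reals boolp.
From mathcomp Require Import ring lra zify.

Set Implicit Arguments.
Unset Strict Implicit.
Unset Printing Implicit Defensive.

Import Order.TTheory GRing.Theory Num.Theory.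
Local Open Scope ring_scope.

(* Containers. Fix an independent set I of an (r+1)-uniform hypergraph G with N
   vertices and e edges. Grow S inside I together with an r-uniform link family
   L, each edge of which extends to an edge of G by a vertex of S. A new vertex
   v contributes its links in G, except those that contain a set whose degree in
   L has already reached half of its allowed value; v is accepted if it
   contributes at least e/(4N) links. If S reaches size b, then L is dense, obeys
   degree bounds of the same shape, has I as an independent set, and we recurse
   on the uniformity. Otherwise no vertex of I outside S can be accepted, while
   double counting shows that a positive proportion of all vertices could be:
   these vertices can be removed from the container. Fixing one L for every S
   makes the container a function of the resulting sequence of sets alone, with
   no ordering of the elements of S to remember. Iterating inside the container
   until it spans fewer than eps * e edges takes boundedly many rounds.

   Counting. The fingerprint is a tuple of t sets with union S, where s := |S| is
   a small fraction of m, and a given S is the union of at most 2^(t s) such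
   tuples. By stability, a container either has fewer than (alpha - eps) N
   vertices or is nearly contained in a member of B; in both cases it yields at
   most (1 - eps)^(m - s) binom(alpha N, m - s) of the sets to be counted.
   Summing over S costs a factor \sum_s C(m, s) K^s with K constant, and since s
   is small this is absorbed by weakening 1 - eps to 1 - eps / 4. *)

(** * Link families *)

Lemma sum_count (T : Type) (J : finType) (P : pred J) (r : J -> pred T)
    (s : seq T) :
  (\sum_(j | P j) count (r j) s = \sum_(x <- s) #|[pred j | P j && r j x]|)%N.
Proof.
under eq_bigr do rewrite -sum1_count big_mkcond /=.
rewrite exchange_big /=; apply: eq_bigr => x _.
by rewrite -sum1_card big_mkcondr.
Qed.

Section LinkFamilies.
Variables (R : realType) (V : finType).
Implicit Types (G L : seq {set V}) (S T A I : {set V}).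

Definition cdeg G T := count (fun A => T \subset A) G.
Definition indep G I := all (fun A => ~~ (A \subset I)) G.

Lemma sum_cdeg G : (\sum_T cdeg G T = \sum_(A <- G) 2 ^ #|A|)%N.
Proof.
rewrite sum_count; apply: eq_bigr => A _; rewrite -card_powerset.
by apply: eq_card => T; rewrite !inE.
Qed.

Lemma sum_cdeg1 G (P : pred {set V}) :
  (\sum_v count (fun A => (v \in A) && P A) G = \sum_(A <- G | P A) #|A|)%N.
Proof.
rewrite sum_count [RHS]big_mkcond; apply: eq_bigr => A _.
by case: (P A); [apply: eq_card | apply: eq_card0] => v; rewrite !inE ?andbT ?andbF.
Qed.

Lemma count_hit G (M : pred {set V}) :
  (count (fun A => [exists T, M T && (T \subset A)]) G
     <= \sum_(T | M T) cdeg G T)%N.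
Proof.
rewrite sum_count -sum1_count big_mkcond; apply: leq_sum => A _.
by case: existsP => // -[T MT]; apply/card_gt0P; exists T.
Qed.

(** The upper size bound keeps saturated sets few; the lower one turns [D] into degree bounds
    relative to [size L], as the recursion needs. *)
Definition link_family G (lo hi : R) (D : nat -> R) S L :=
  [/\ forall A, A \in L -> exists2 v, v \in S & (v \notin A) && (v |: A \in G),
      forall T, T != set0 -> (cdeg L T)%:R <= D #|T|,
      lo * #|S|%:R <= (size L)%:R
    & (size L)%:R <= hi * #|S|%:R].

(* The factor 1/2 leaves room for the links of one more vertex. *)
Definition saturated (D : nat -> R) L T :=
  (T != set0) && (D #|T| / 2 <= (cdeg L T)%:R).

Definition free_links G (sat : pred {set V}) v :=
  [seq A :\ v | A <- G & (v \in A) && ~~ [exists T, sat T && (T \subset A :\ v)]].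

Lemma size_free_links G sat v : (size (free_links G sat v) <= cdeg G [set v])%N.
Proof.
by rewrite size_map size_filter; apply: sub_count => A /andP[vA _]; rewrite sub1set.
Qed.

Lemma free_links_sat G (sat : pred {set V}) v T :
  sat T -> cdeg (free_links G sat v) T = 0%N.
Proof.
move=> sT; apply/eqP; rewrite -leqn0 leqNgt -has_count; apply/hasPn => _ /mapP[A + ->].
rewrite mem_filter => /andP[/andP[_ /existsPn nosat] _].
by have := nosat T; rewrite sT.
Qed.

Lemma cdeg_free_links G sat v T :
  (cdeg (free_links G sat v) T <= (v \notin T) * cdeg G (v |: T))%N.
Proof.
rewrite /cdeg count_map count_filter; case: (boolP (v \in T)) => /= vT.
  rewrite leqNgt -has_count; apply/hasPn => A _ /=.
  by rewrite subsetD1 vT andbF.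
rewrite mul1n; apply: sub_count => A /= /andP[TA /andP[vA _]].
by rewrite subUset sub1set vA; apply: subset_trans TA (subsetDl _ _).
Qed.

Lemma link_family0 G lo hi (D : nat -> R) :
  (forall j, 0 <= D j) -> link_family G lo hi D set0 [::].
Proof. by move=> D0; split; rewrite ?cards0 ?mulr0. Qed.

(** A saturated [T] gains no links. Any other [T] is below half of [D #|T|] and gains at most the
    degree of [v |: T] in [G], which fits in the other half. *)
Lemma link_familyU1 G lo hi (D : nat -> R) S L v :
    (forall T, T != set0 -> v \notin T -> (cdeg G (v |: T))%:R <= D #|T| / 2) ->
    (cdeg G [set v])%:R <= hi -> (forall j, 0 <= D j) -> v \notin S ->
    lo <= (size (free_links G (saturated D L) v))%:R ->
    link_family G lo hi D S L ->
  link_family G lo hi D (v |: S) (L ++ free_links G (saturated D L) v).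
Proof.
move=> degG degv D0 vS lov [linkL degL loL hiL]; set F := free_links _ _ _ in lov *.
split=> [A|T T0||].
- rewrite mem_cat => /orP[/linkL[u uS uA]|/mapP[A' + ->]].
    by exists u => //; rewrite inE uS orbT.
  rewrite mem_filter => /andP[/andP[vA' _] A'G]; exists v; first exact: setU11.
  by rewrite setD11 setD1K.
- rewrite /cdeg count_cat -/(cdeg L T) -/(cdeg F T).
  case: (boolP (saturated D L T)) => [satT|].
    by rewrite /F free_links_sat // addn0 degL.
  rewrite /saturated T0 /= -ltNge => degLT; rewrite natrD.
  suff: (cdeg F T)%:R <= D #|T| / 2 by lra.
  have := cdeg_free_links G (saturated D L) v T; rewrite -/F.
  case: (boolP (v \in T)) => vT /=; rewrite ?mul0n ?mul1n.
    by rewrite leqn0 => /eqP->; rewrite divr_ge0.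
  by rewrite -(ler_nat R) => /le_trans; apply; apply: degG.
- by rewrite size_cat cardsU1 vS /= !natrD mulrDr mulr1 addrC lerD // addrC.
- rewrite size_cat cardsU1 vS /= !natrD mulrDr mulr1 addrC lerD //.
  by apply: le_trans degv; rewrite ler_nat size_free_links.
Qed.

End LinkFamilies.

(** * Containers *)

(** The degree hypothesis of the theorem with [q] for [p], asked of nonempty sets of every size so
    that no uniformity has to be mentioned. *)
Definition capped (R : realType) (V : finType) (c q : R) (G : seq {set V}) :=
  forall T : {set V}, T != set0 ->
    (cdeg G T)%:R <= c * q ^+ (#|T| - 1) * ((size G)%:R / #|V|%:R).

(** Saturated sets have large degree in [L], while all degrees in [L] sum to [2 ^ r * size L]; hence
    at most half of the edges of [G] contain one. The other edges yield at least [size G / 2] links,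
    of which vertices outside the set carry at most [size G / 4] in total; each vertex inside
    carries at most [c * (size G / #|V|)]. *)
Lemma card_unsaturated (R : realType) (V : finType) (r b : nat) (c K : R)
    (G L : seq {set V}) (q := b%:R / #|V|%:R)
    (D := fun j => K * q ^+ j * ((size G)%:R / #|V|%:R)) :
    0 < c -> 0 < K -> 2 ^+ r.+2 * c ^+ 2 <= K -> (0 < #|V|)%N -> (0 < b)%N ->
    (0 < size G)%N -> all (fun A => A != set0) G -> capped c q G ->
    (forall A, A \in L -> #|A| = r) ->
    (size L)%:R <= c * ((size G)%:R / #|V|%:R) * b%:R ->
  #|V|%:R <= 4 * c * #|[set v | (size G)%:R / (4 * #|V|%:R)
                   <= (size (free_links G (saturated D L) v))%:R :> R]|%:R.
Proof.
move=> c0 K0 Kc V0 b0 G0 Gn0 capG cardL sizeL; set W := [set v | _].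
have VR : 0 < #|V|%:R :> R by rewrite ltr0n.
have bR : 0 < b%:R :> R by rewrite ltr0n.
have eR : 0 < (size G)%:R :> R by rewrite ltr0n.
have q0 : 0 < q by rewrite divr_gt0.
pose sat := saturated D L.
pose bad (A : {set V}) := [exists T, sat T && (T \subset A)].
have bad_half : (count bad G)%:R <= (size G)%:R / 2 :> R.
  have sumL : (\sum_T (cdeg L T)%:R = 2 ^+ r * (size L)%:R :> R)%R.
    rewrite -natr_sum sum_cdeg (eq_big_seq (fun _ => 2 ^ r)%N).
      by rewrite big_const_seq count_predT iter_addn_0 natrM natrX.
    by move=> A /cardL->.
  (* The cap on [G] has exponent [#|T| - 1] and saturation has [#|T|], whence the extra factor
     [q]. *)
  have degKq T : sat T -> (cdeg G T)%:R * (K * q) <= 2 * c * (cdeg L T)%:R.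
    case/andP=> T0 /=; have := capG T T0.
    have : (0 < #|T|)%N by rewrite card_gt0.
    rewrite /D; case: #|T| => // j _; rewrite subn1 /= => capT satT.
    have := ler_wpM2r (ltW (mulr_gt0 K0 q0)) capT.
    have := ler_wpM2l (ltW c0) satT.
    by rewrite exprS; lra.
  have := count_hit G sat; rewrite -(ler_nat R) natr_sum => le_sum.
  have : (count bad G)%:R * (K * q) <= 2 * c * (2 ^+ r * (size L)%:R) :> R.
    apply: le_trans (ler_wpM2r (ltW (mulr_gt0 K0 q0)) le_sum) _.
    rewrite mulr_suml -sumL mulr_sumr big_mkcond /=; apply: ler_sum => T _.
    by case: ifP => [/degKq//|_]; rewrite !mulr_ge0 // ltW.
  move=> badKq; rewrite -(ler_pM2r (mulr_gt0 K0 q0)); apply: le_trans badKq _.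
  have pow0 : 0 < 2 ^+ r :> R by rewrite exprn_gt0.
  have hi : 2 * c * (2 ^+ r * (size L)%:R)
      <= (2 ^+ r.+2 * c ^+ 2) * (q * ((size G)%:R / 2)).
    have := ler_wpM2l (ltW (mulr_gt0 c0 pow0)) sizeL.
    by rewrite /q !exprS; lra.
  apply: le_trans hi _.
  have -> : (size G)%:R / 2 * (K * q) = K * (q * ((size G)%:R / 2)) by ring.
  by rewrite ler_wpM2r // ltW // mulr_gt0 // divr_gt0.
have good_half : (size G)%:R / 2 <= (count (predC bad) G)%:R :> R.
  have := count_predC bad G => /(congr1 (fun n => n%:R : R)).
  rewrite natrD; lra.
have sum_low : (size G)%:R / 2
    <= \sum_v (size (free_links G sat v))%:R :> R.
  apply: le_trans good_half _; rewrite -natr_sum ler_nat.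
  have le1 : (count (predC bad) G
      <= \sum_(v : V) count (fun A : {set V} => (v \in A) && ~~ bad A) G)%N.
    rewrite sum_cdeg1 -sum1_count big_seq_cond [leqRHS]big_seq_cond.
    apply: leq_sum => A /andP[AG _]; rewrite card_gt0.
    exact: (allP Gn0).
  apply: leq_trans le1 _; apply: leq_sum => v _; rewrite size_map size_filter.
  apply: sub_count => A /andP[vA /existsPn nbad]; rewrite /= vA /=.
  apply/existsPn => T; apply: contra (nbad T) => /andP[-> TA] /=.
  by apply: subset_trans TA (subsetDl _ _).
have sum_up : \sum_v (size (free_links G sat v))%:R
    <= c * ((size G)%:R / #|V|%:R) * #|W|%:R + (size G)%:R / 4 :> R.
  have -> : (size G)%:R / 4 = \sum_(v : V) (size G)%:R / (4 * #|V|%:R) :> R.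
    by rewrite sumr_const -mulr_natr; field; rewrite gt_eqF.
  have -> : c * ((size G)%:R / #|V|%:R) * #|W|%:R
      = \sum_v if v \in W then c * ((size G)%:R / #|V|%:R) else 0.
    by rewrite -big_mkcond sumr_const mulr_natr.
  rewrite -big_split /=; apply: ler_sum => v _; rewrite !inE.
  case: ifPn => [_|]; last by rewrite -ltNge add0r => /ltW.
  apply: (@le_trans _ _ (c * ((size G)%:R / #|V|%:R))).
    have := capG [set v]; rewrite cards1 subnn expr0 mulr1 => /(_ _) capv.
    apply: le_trans (capv _); first by rewrite ler_nat size_free_links.
    by rewrite -card_gt0 cards1.
  by rewrite lerDl divr_ge0 // mulr_ge0.
have : (size G)%:R / 4 <= c * ((size G)%:R / #|V|%:R) * #|W|%:R by lra.
rewrite -(ler_pM2r (_ : 0 < 4 * #|V|%:R / (size G)%:R)); last first.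
  by rewrite divr_gt0 // mulr_gt0.
congr (_ <= _); field; by rewrite ?gt_eqF.
Qed.

Lemma cdeg1_gt0P (V : finType) (G : seq {set V}) v :
  reflect (exists2 A, A \in G & v \in A) (0 < cdeg G [set v])%N.
Proof.
rewrite -has_count; apply: (iffP hasP) => -[A AG].
  by rewrite sub1set; exists A.
by move=> vA; exists A => //; rewrite sub1set.
Qed.

Definition unions (V : finType) (tau : seq {set V}) : {set V} :=
  \bigcup_(S <- tau) S.

(* [f] maps a fingerprint to vertices that an independent set producing it
   avoids, apart from those in the fingerprint itself. *)
Definition separated (R : realType) (V : finType) (t b : nat) (x : R)
    (G : seq {set V}) (f : seq {set V} -> {set V}) :=
  forall I, indep G I -> exists tau : seq {set V},
    [/\ size tau = t, all (fun S : {set V} => (S \subset I) && (#|S| <= b)%N) tau,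
        I :&: f tau \subset unions tau, x <= #|f tau|%:R
      & forall v, v \in f tau -> (0 < cdeg G [set v])%N].

Lemma separated_singletons (R : realType) (V : finType) (b : nat) (c : R)
    (G : seq {set V}) :
    0 < c -> (forall A, A \in G -> #|A| = 1%N) -> (0 < size G)%N ->
    (forall v, (cdeg G [set v])%:R <= c * ((size G)%:R / #|V|%:R)) ->
  separated 0 b (c^-1 * #|V|%:R) G (fun=> [set v | (0 < cdeg G [set v])%N]).
Proof.
move=> c0 cardG G0 degG I indI; exists [::]; split=> // [||v]; last by rewrite inE.
  apply/subsetP => v; rewrite !inE => /andP[vI /cdeg1_gt0P[A AG vA]].
  have /allP/(_ A AG)/negP[] := indI.
  have /eqP/cards1P[u Au] := cardG A AG.
  by move: vA; rewrite Au sub1set inE => /eqP<-.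
set W := [set v | _].
have eR : 0 < (size G)%:R :> R by rewrite ltr0n.
have VR : 0 < #|V|%:R :> R.
  case: G G0 cardG {degG indI W eR} => // A G _ /(_ A (mem_head _ _)) A1.
  by rewrite ltr0n (leq_trans _ (max_card (mem A))) // A1.
have sizeE : (size G = \sum_v cdeg G [set v])%N.
  rewrite sum_count -sum1_size; apply: eq_big_seq => A /cardG<-.
  by apply: eq_card => v; rewrite !inE sub1set.
have : (size G)%:R <= \sum_v if v \in W then c * ((size G)%:R / #|V|%:R) else 0 :> R.
  rewrite [X in X%:R <= _]sizeE natr_sum; apply: ler_sum => v _; rewrite inE.
  by case: posnP => [->|].
rewrite -big_mkcond sumr_const -[leRHS]mulr_natr => le_e.
rewrite -(ler_pM2r (mulr_gt0 c0 (divr_gt0 eR VR))) [leRHS]mulrC.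
apply: le_trans le_e; rewrite le_eqVlt; apply/orP; left; apply/eqP; field.
by rewrite !gt_eqF.
Qed.

Lemma uniform_verts (V : finType) (r : nat) (G : seq {set V}) :
  (0 < size G)%N -> (forall A, A \in G -> #|A| = r.+1) -> (0 < #|V|)%N.
Proof.
case: G => // A G _ /(_ A (mem_head _ _)) A1.
by rewrite (leq_trans _ (max_card (mem A))) // A1.
Qed.

Lemma container_step (R : realType) (r : nat) (c : R) : 0 < c ->
  exists2 gamma : R, 0 < gamma &
  forall (V : finType) (b : nat) (G : seq {set V}),
    (forall A, A \in G -> #|A| = r.+1) -> (0 < size G)%N ->
    capped c (b%:R / #|V|%:R) G ->
  exists f, separated r b (gamma * #|V|%:R) G f.
Proof.
elim: r c => [|r IHr] c c0.
  exists c^-1; first by rewrite invr_gt0.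
  move=> V b G cardG G0 capG; exists (fun=> [set v | (0 < cdeg G [set v])%N]).
  apply: separated_singletons => // v; have := capG [set v].
  rewrite cards1 subnn expr0 mulr1; apply.
  by rewrite -card_gt0 cards1.
(* The first summand serves [card_unsaturated] at uniformity [r.+1], the second makes [c] at most
   [K / 2] for [link_familyU1]. *)
pose K := 2 ^+ r.+3 * c ^+ 2 + 2 * c.
have K0 : 0 < K.
  by rewrite /K addr_gt0 // mulr_gt0 // exprn_gt0.
have K40 : 0 < 4 * K by rewrite mulr_gt0.
(* A link family of a set of size [b] has at least [q * size G / 4] edges, so the bounds [D] become
   a cap with constant [4 * K]. *)
have [gamma' gamma'0 {}IHr] := IHr (4 * K) K40.
have c40 : 0 < (4 * c)^-1 by rewrite invr_gt0 mulr_gt0.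
exists (Num.min gamma' (4 * c)^-1); first by rewrite lt_min gamma'0.
move=> V b G cardG G0 capG.
have V0 := uniform_verts G0 cardG.
set gamma := Num.min _ _.
have VR : 0 < #|V|%:R :> R by rewrite ltr0n.
have eR : 0 < (size G)%:R :> R by rewrite ltr0n.
(* For [b = 0] the degree bounds would force an edge to have degree 0. *)
have b0 : (0 < b)%N.
  rewrite lt0n; apply/eqP => b0; case: G G0 cardG capG {eR} => // A G _ cardG capG.
  have A2 := cardG A (mem_head _ _).
  have := capG A; rewrite -card_gt0 A2 b0 mul0r subn1 exprS mul0r mulr0 mul0r.
  move=> /(_ isT); rewrite lern0 -leqn0 leqNgt -has_count => /negP[].
  by apply/hasP; exists A; rewrite ?mem_head.
have bR : 0 < b%:R :> R by rewrite ltr0n.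
pose q : R := b%:R / #|V|%:R; have q0 : 0 < q by rewrite divr_gt0.
pose D j := K * q ^+ j * ((size G)%:R / #|V|%:R).
pose lo : R := (size G)%:R / (4 * #|V|%:R).
pose hi : R := c * ((size G)%:R / #|V|%:R).
pose good := link_family G lo hi D.
have D0 j : 0 <= D j.
  by rewrite !mulr_ge0 ?exprn_ge0 ?invr_ge0 //; exact: ltW.
have cardL S L A : good S L -> A \in L -> #|A| = r.+1.
  case=> linkL _ _ _ /linkL[v _ /andP[vA /cardG]].
  by rewrite cardsU1 vA => -[].
(* One link family is chosen for each [S], since decoding must not depend on [I]. *)
have [Lf goodLf] : exists Lf, forall S, (exists L, good S L) -> good S (Lf S).
  apply: (@fin_all_exists {set V} (fun=> seq {set V})
    (fun S L => (exists L', good S L') -> good S L)) => S.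
  have [[L gL]|no] := EM (exists L, good S L).
    by exists L.
  by exists [::] => /no.
have [ff fP] : exists ff, forall S : {set V}, good S (Lf S) -> #|S| = b ->
    separated r b (gamma' * #|V|%:R) (Lf S) (ff S).
  apply: (@fin_all_exists {set V} (fun=> seq {set V} -> {set V})
    (fun S f => good S (Lf S) -> #|S| = b ->
                separated r b (gamma' * #|V|%:R) (Lf S) f)) => S.
  have [[gS Sb]|no] := EM (good S (Lf S) /\ #|S| = b); last first.
    by exists (fun=> set0) => gS Sb; case: no.
  have [_ degL loL _] := gS.
  have loLq : q * (size G)%:R <= 4 * (size (Lf S))%:R.
    move: loL; rewrite Sb /lo /q => loL.
    have -> : b%:R / #|V|%:R * (size G)%:R
        = 4 * ((size G)%:R / (4 * #|V|%:R) * b%:R) :> R by field; rewrite gt_eqF.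
    by rewrite ler_wpM2l.
  have [||T T0|f fP] := IHr V b (Lf S); last by exists f.
  - by move=> A; apply: cardL gS.
  - rewrite -(ltr0n R); have := mulr_gt0 q0 eR; lra.
  - apply: le_trans (degL T T0) _; have : (0 < #|T|)%N by rewrite card_gt0.
    rewrite /D; case: #|T| => // j _; rewrite subn1 /= -/q exprS.
    have w0 : 0 <= K * q ^+ j / #|V|%:R.
      by rewrite !mulr_ge0 ?exprn_ge0 ?invr_ge0 //; exact: ltW.
    by have := ler_wpM2l w0 loLq; lra.
pose stuck S := [set v | lo <= (size (free_links G (saturated D (Lf S)) v))%:R].
(* The size of the first set tells the two outcomes apart: exactly [b] means recursion into the
   links, less means that growth got stuck. *)
exists (fun tau : seq {set V} => if tau is T :: tau' then
                     if #|T| == b then ff T tau' else stuck T else set0).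
move=> I indI.
have grow j : (j <= b)%N ->
    (exists S : {set V}, [/\ S \subset I, good S (Lf S) & #|S| = j]) \/
    (exists S : {set V}, [/\ S \subset I, good S (Lf S), (#|S| < b)%N
                 & I :&: stuck S \subset S]).
  elim: j => [_|j IHj jb].
    left; exists set0; rewrite sub0set cards0; split=> //.
    by apply: goodLf; exists [::]; apply: link_family0.
  case: (IHj (ltnW jb)) => [[S [SI gS Sj]]|]; last by right.
  case: (boolP (I :&: stuck S \subset S)) => [stS|].
    by right; exists S; rewrite Sj.
  case/subsetPn => v; rewrite !inE => /andP[vI lov] vS.
  left; exists (v |: S); split; last by rewrite cardsU1 vS Sj.
    by rewrite subUset sub1set vI.
  apply: goodLf; eexists; apply: link_familyU1 gS => // [T T0 vT|].
    have vT0 : v |: T != set0 by apply/set0Pn; exists v; rewrite setU11.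
    apply: le_trans (capG _ vT0) _; rewrite cardsU1 vT add1n subn1 /= /D /K -/q.
    have pow0 : 0 <= 2 ^+ r.+3 :> R by apply: exprn_ge0.
    have := mulr_ge0 (mulr_ge0 (mulr_ge0 pow0 (sqr_ge0 c)) (exprn_ge0 #|T| (ltW q0)))
      (ltW (divr_gt0 eR VR)).
    by lra.
  have := capG [set v]; rewrite cards1 subnn expr0 mulr1; apply.
  by rewrite -card_gt0 cards1.
case: (grow b (leqnn b)) => -[S [SI gS]].
  move=> Sb; have [|tau [sztau subtau sepI leW Wdeg]] := fP S gS Sb I.
    apply/allP => A AL; apply/negP => AI.
    have [linkL _ _ _] := gS; have [v vS /andP[vA AG]] := linkL A AL.
    have /allP/(_ _ AG)/negP[] := indI.
    by rewrite subUset sub1set AI (subsetP SI).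
  exists (S :: tau); rewrite Sb eqxx /unions big_cons; split=> /=.
  - by rewrite sztau.
  - by rewrite SI Sb leqnn.
  - exact: subset_trans sepI (subsetUr _ _).
  - by apply: le_trans leW; rewrite ler_wpM2r ?ler0n // ge_min lexx.
  - move=> v /Wdeg/cdeg1_gt0P[A AL vA]; apply/cdeg1_gt0P.
    have [linkL _ _ _] := gS; have [u _ /andP[_ AG]] := linkL A AL.
    by exists (u |: A) => //; rewrite inE vA orbT.
(* Empty sets pad the fingerprint to the length of the recursive case. *)
move=> Sb stS; exists (S :: nseq r set0); rewrite ltn_eqF // /unions big_cons; split=> /=.
- by rewrite size_nseq.
- by rewrite SI ltnW //=; apply/allP => A /nseqP[-> _]; rewrite sub0set cards0.
- exact: subset_trans stS (subsetUl _ _).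
- have /(_ V r.+1 b c K G (Lf S) c0 K0) := @card_unsaturated R.
  rewrite V0 b0 G0 => /(_ _ isT isT isT _ capG) bound.
  have leW : #|V|%:R <= 4 * c * #|stuck S|%:R.
    apply: bound; first by rewrite /K lerDl mulr_ge0 // ltW.
    - by apply/allP => A AG; rewrite -card_gt0 (cardG A AG).
    - by move=> A; apply: cardL gS.
    - have [_ _ _ hiL] := gS; apply: le_trans hiL _; rewrite /hi.
      apply: ler_wpM2l; last by rewrite ler_nat ltnW.
      by apply: mulr_ge0 (ltW c0) (ltW (divr_gt0 eR VR)).
  apply: (@le_trans _ _ ((4 * c)^-1 * #|V|%:R)).
    by rewrite ler_wpM2r // ge_min lexx orbT.
  by rewrite mulrC ler_pdivrMr ?mulr_gt0 // mulrC.
- move=> v; rewrite inE => lov; apply: leq_trans (size_free_links G (saturated D (Lf S)) v).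
  by rewrite -(ltr0n R); apply: lt_le_trans lov; rewrite divr_gt0 ?mulr_gt0.
Qed.

(** Capturing only [I :&: X] lets the induction shrink [X] while [G] and its vertex type stay
    fixed. *)
Definition contained (R : realType) (V : finType) (t b : nat) (x : R)
    (G : seq {set V}) (X : {set V}) (f : seq {set V} -> {set V}) :=
  forall I, indep G I -> exists tau : seq {set V},
    [/\ size tau = t, all (fun S : {set V} => (S \subset I) && (#|S| <= b)%N) tau,
        (I :&: X) :\: unions tau \subset f tau
      & (count (fun A : {set V} => A \subset f tau) G)%:R < x].

(** The iteration may stop early; padding keeps the fingerprint length at [t]. *)
Lemma contained_const (R : realType) (V : finType) (t b : nat) (x : R)
    (G : seq {set V}) (X : {set V}) :
    (count (fun A : {set V} => A \subset X) G)%:R < x ->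
  contained t b x G X (fun=> X).
Proof.
move=> ltx I _; exists (nseq t set0); split=> //; first by rewrite size_nseq.
  by apply/allP => A /nseqP[-> _]; rewrite sub0set cards0.
by apply: subset_trans (subsetDl _ _) (subsetIr _ _).
Qed.

(** The first [r] sets record the vertices of [I] in the removed set; fixed lengths let [take] and
    [drop] separate the rounds. *)
Lemma contained_step (R : realType) (V : finType) (r t b : nat) (x y : R)
    (G : seq {set V}) (X : {set V}) (w : seq {set V} -> {set V})
    (g : {set V} -> seq {set V} -> {set V}) :
    separated r b y [seq A : {set V} <- G | A \subset X] w ->
    (forall W : {set V}, W \subset X -> y <= #|W|%:R ->
       contained t b x G (X :\: W) (g W)) ->
  contained (r + t) b x G X (fun tau => g (w (take r tau)) (drop r tau)).
Proof.
move=> sepw contg I indI.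
have [|tau [sztau subtau sepI leW Wdeg]] := sepw I.
  by apply/allP => A; rewrite mem_filter => /andP[_ /(allP indI)].
(* The last clause of [separated] enters here: each vertex of [w tau] lies on an edge inside [X]. *)
have WX : w tau \subset X.
  apply/subsetP => v /Wdeg/cdeg1_gt0P[A]; rewrite mem_filter => /andP[/subsetP AX _].
  exact: AX.
have [tau' [sztau' subtau' contI ltx]] := contg _ WX leW I indI.
exists (tau ++ tau'); rewrite size_cat all_cat sztau sztau' subtau subtau'.
rewrite take_size_cat // drop_size_cat //; split=> //.
apply/subsetP => v; rewrite /unions big_cat !inE negb_or -!andbA.
case/and4P=> vtau vtau' vI vX; apply: (subsetP contI).
rewrite !inE vtau' vI vX /= andbT; apply: contra vtau => vW.
by apply: (subsetP sepI); rewrite inE vI.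
Qed.

Lemma containers (R : realType) (r : nat) (c eps : R) : 0 < c -> 0 < eps ->
  exists n : nat, forall (V : finType) (b : nat) (G : seq {set V}),
    (forall A, A \in G -> #|A| = r.+1) -> (0 < size G)%N ->
    capped c (b%:R / #|V|%:R) G ->
  exists f, contained (n * r) b (eps * (size G)%:R) G setT f.
Proof.
move=> c0 eps0.
(* As long as [X] spans at least [eps * size G] edges, restricting to them worsens [c] by a factor
   [eps^-1] at most. *)
have [gamma gamma0 step] := container_step r (divr_gt0 c0 eps0).
(* Each round removes at least [gamma * #|V|] vertices. *)
exists (Num.truncn gamma^-1).+1 => V b G cardG G0 capG.
have V0 := uniform_verts G0 cardG.
have VR : 0 < #|V|%:R :> R by rewrite ltr0n.
have gV : 0 < gamma * #|V|%:R by rewrite mulr_gt0.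
suff iter n (X : {set V}) : #|X|%:R <= n%:R * (gamma * #|V|%:R) ->
    exists f, contained (n * r) b (eps * (size G)%:R) G X f.
  apply: iter; rewrite cardsT mulrA ler_peMl ?ler0n //.
  by rewrite -ler_pdivrMr // div1r ltW // truncnS_gt.
elim: n X => [|n IHn] X leX.
  exists (fun=> X); apply: contained_const.
  have -> : count (fun A : {set V} => A \subset X) G = 0%N.
    apply/eqP; rewrite -leqn0 leqNgt -has_count; apply/hasPn => A /cardG A1.
    apply/negP => /subset_leq_card; rewrite A1 ltnNge => /negP; apply.
    by move: leX; rewrite mul0r lern0 => /eqP->.
  by rewrite mulr_gt0 // ltr0n.
have [ltx|] := ltP (count (fun A : {set V} => A \subset X) G)%:R (eps * (size G)%:R).
  by exists (fun=> X); apply: contained_const.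
rewrite -size_filter; set GX := filter _ _ => leGX.
have GX0 : (0 < size GX)%N.
  by rewrite -(ltr0n R); apply: lt_le_trans leGX; rewrite mulr_gt0 // ltr0n.
have [||w sepw] := step V b GX _ GX0.
- by move=> A; rewrite mem_filter => /andP[_ /cardG].
- move=> T T0; have := capG T T0; set d := cdeg G T => capT.
  apply: (@le_trans _ _ d%:R).
    by rewrite ler_nat /d /cdeg count_filter; apply: sub_count => A /andP[].
  apply: le_trans capT _.
  have q0 : 0 <= (b%:R / #|V|%:R) ^+ (#|T| - 1) :> R.
    by rewrite exprn_ge0 // divr_ge0.
  have w0 := divr_ge0 (divr_ge0 (mulr_ge0 (ltW c0) q0) (ltW eps0)) (ltW VR).
  have := ler_wpM2l w0 leGX; congr (_ <= _); field; rewrite ?gt_eqF //.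
have [g gP] : exists g, forall W : {set V}, W \subset X ->
    gamma * #|V|%:R <= #|W|%:R ->
    contained (n * r) b (eps * (size G)%:R) G (X :\: W) (g W).
  apply: (@fin_all_exists {set V} (fun=> seq {set V} -> {set V})
    (fun W f => W \subset X -> gamma * #|V|%:R <= #|W|%:R ->
       contained (n * r) b (eps * (size G)%:R) G (X :\: W) f)) => W.
  have [[WX leW]|no] := EM (W \subset X /\ gamma * #|V|%:R <= #|W|%:R); last first.
    by exists (fun=> set0) => WX leW; case: no.
  have [|f fP] := IHn (X :\: W); last by exists f.
  rewrite cardsD (setIidPr WX) natrB ?subset_leq_card //.
  by move: leX; rewrite mulrSr; lra.
eexists; rewrite mulSn; exact: contained_step sepw gP.
Qed.

(** * Binomial estimates *)

Lemma ffact_leq_exp n j : (n ^_ j <= n ^ j)%N.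
Proof.
elim: j => // j IHj; rewrite ffactnSr expnSr leq_mul //; exact: leq_subr.
Qed.

Lemma bin_leq_exp2 n j : ('C(n, j) <= 2 ^ n)%N.
Proof.
rewrite -[in leqRHS](card_ord n) -cardsT -card_powerset -{1}(card_ord n) -card_draws.
by rewrite subset_leq_card //; apply/subsetP => A _; rewrite !inE subsetT.
Qed.

Lemma rbinom_fact (R : realType) (x : R) m :
  rbinom x m * m`!%:R = \prod_(i < m) (x - i%:R).
Proof. by rewrite /rbinom mulfVK // pnatr_eq0 -lt0n fact_gt0. Qed.

Lemma rbinom_ge0 (R : realType) (x : R) m : m%:R <= x -> 0 <= rbinom x m.
Proof.
move=> lemx; rewrite divr_ge0 // prodr_ge0 // => i _; rewrite subr_ge0.
by apply: le_trans lemx; rewrite ler_nat ltnW.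
Qed.

(** Factorwise comparison. Truncated subtraction is right here: [n ^_ j] has a zero factor when
    [n < j]. *)
Lemma bin_le_rbinom (R : realType) (x rho : R) (n j : nat) :
    (forall i : 'I_j, (n - i)%N%:R <= rho * (x - i%:R)) ->
  'C(n, j)%:R <= rho ^+ j * rbinom x j.
Proof.
move=> le_i; rewrite -(ler_pM2r (_ : 0 < j`!%:R)) ?ltr0n ?fact_gt0 //.
rewrite -mulrA rbinom_fact -natrM bin_ffact ffact_prod natr_prod.
rewrite -[j in rho ^+ j]card_ord -prodr_const -big_split /=.
by apply: ler_prod => i _; rewrite le_i ler0n.
Qed.

Lemma bin_le_shrunk_rbinom (R : realType) (x y a e : R) (n j : nat) :
    n%:R <= x - e * y -> x = a * y -> a <= 1 -> 0 <= y -> 0 <= e <= 1 ->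
    j%:R <= x ->
  'C(n, j)%:R <= (1 - e) ^+ j * rbinom x j.
Proof.
move=> len xE a1 y0 /andP[e0 e1] lejx; apply: bin_le_rbinom => i.
have ix : i%:R <= x by apply: le_trans lejx; rewrite ler_nat ltnW.
have [lein|ltni] := leqP i n; last first.
  have -> : (n - i)%N = 0%N by lia.
  by rewrite mulr_ge0 ?subr_ge0.
rewrite natrB //.
have : 0 <= e * (y - x) by rewrite mulr_ge0 // xE; nra.
have : 0 <= e * i%:R by rewrite mulr_ge0.
by nra.
Qed.

(** This serves containers close to a member of [B]: [h] elements come from a set of [w] vertices,
    and [w] is so small that [w ^ h] outweighs all exponential losses in [m]. *)
Lemma bin_mul_le_rbinom (R : realType) (a : R) (N w h l m M : nat) :
    0 < a <= 1 -> w%:R <= (a / 8) ^+ M * N%:R -> (m <= M * h)%N ->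
    (h + l <= m)%N -> m%:R <= a * N%:R / 2 ->
  ('C(w, h) * 'C(N, l))%:R <= 2^-1 ^+ m * rbinom (a * N%:R) (h + l).
Proof.
move=> /andP[a0 a1] lew lemM lejm lem; set j := (h + l)%N.
have j0 : 0 < j`!%:R :> R by rewrite ltr0n fact_gt0.
rewrite -(ler_pM2r j0) -mulrA rbinom_fact.
have NR : 0 <= N%:R :> R by [].
have low : (a * N%:R / 2) ^+ j <= \prod_(i < j) (a * N%:R - i%:R).
  rewrite -[j in _ ^+ j]card_ord -prodr_const; apply: ler_prod => i _.
  have : i%:R <= m%:R :> R.
    by rewrite ler_nat (leq_trans (ltnW (ltn_ord i))).
  have : 0 <= a * N%:R by rewrite mulr_ge0 // ltW.
  by move=> aN im; apply/andP; split; lra.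
have h0 : 0 <= 2^-1 :> R by rewrite invr_ge0.
have p0 : 0 <= 2^-1 ^+ m :> R by rewrite exprn_ge0.
apply: le_trans (ler_wpM2l p0 low).
have binE : ('C(w, h) * 'C(N, l) * j`! = w ^_ h * N ^_ l * 'C(j, h))%N.
  rewrite -(bin_fact (leq_addr l h)) -/j [(j - h)%N]addKn -!bin_ffact; ring.
rewrite -natrM binE.
apply: (@le_trans _ _ (w ^ h * N ^ l * 2 ^ j)%N%:R).
  by rewrite ler_nat !leq_mul ?ffact_leq_exp ?bin_leq_exp2.
rewrite !natrM !natrX.
have z0 : 0 <= a / 8 by rewrite divr_ge0 // ltW.
have wh : w%:R ^+ h <= (a / 8) ^+ m * N%:R ^+ h.
  apply: (@le_trans _ _ (((a / 8) ^+ M * N%:R) ^+ h)).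
    by rewrite lerXn2r // nnegrE // mulr_ge0 // exprn_ge0.
  rewrite exprMn -exprM ler_wpM2r ?exprn_ge0 // ler_wiXn2l //; lra.
have -> : 2^-1 ^+ m * (a * N%:R / 2) ^+ j
    = (a / 4) ^+ j * 2^-1 ^+ m * N%:R ^+ h * N%:R ^+ l * 2 ^+ j.
  have -> : a * N%:R / 2 = (a / 4) * N%:R * 2 by field.
  by rewrite !exprMn [N%:R ^+ j]exprD; ring.
rewrite ler_wpM2r ?exprn_ge0 // ler_wpM2r ?exprn_ge0 //.
apply: le_trans wh _; rewrite ler_wpM2r ?exprn_ge0 //.
(* Of the two factors, [(a / 4) ^+ m] pays for [(a / 4) ^+ j], and [2^-1 ^+ m] is the gain. *)
have -> : a / 8 = (a / 4) * 2^-1 by field.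
rewrite exprMn ler_wpM2r // ler_wiXn2l //; lra.
Qed.

(** Raising the lower index from [j] to [j + s] brings in [s] new factors, each at least
    [e * N / 2]; they absorb the cost [N ^ s] of choosing [S]. *)
Lemma bin_mul_rbinom_le (R : realType) (x e : R) (N j s : nat) :
    0 < e -> (0 < N)%N -> (j + s)%:R <= x - e * N%:R / 2 ->
  'C(N, s)%:R * rbinom x j
    <= 'C(j + s, s)%:R * (2 / e) ^+ s * rbinom x (j + s).
Proof.
move=> e0 N0 lejs; have NR : 0 < N%:R :> R by rewrite ltr0n.
have eN : 0 < e * N%:R / 2 by rewrite divr_gt0 // mulr_gt0.
set m := (j + s)%N in lejs *.
have m0 : 0 < m`!%:R :> R by rewrite ltr0n fact_gt0.
rewrite -(ler_pM2r m0) -[leRHS]mulrA rbinom_fact big_split_ord /=.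
set f := \prod_(i < j) _; set g := \prod_(i < s) _.
have f0 : 0 <= f.
  rewrite prodr_ge0 // => i _; rewrite subr_ge0.
  have : i%:R <= m%:R :> R by rewrite ler_nat /m; have := ltn_ord i; lia.
  lra.
have low : (e * N%:R / 2) ^+ s <= g.
  rewrite -[s in _ ^+ s]card_ord -prodr_const; apply: ler_prod => i _.
  have : (j + i)%:R <= m%:R :> R by rewrite ler_nat /m; have := ltn_ord i; lia.
  by move=> im; apply/andP; split; lra.
have -> : 'C(N, s)%:R * rbinom x j * m`!%:R = (N ^_ s)%:R * 'C(m, s)%:R * f.
  rewrite /f -rbinom_fact -(bin_fact (leq_addl j s)) -/m.
  by rewrite /m addnK -bin_ffact !natrM; ring.
have -> : 'C(m, s)%:R * (2 / e) ^+ s * (f * g)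
    = ((2 / e) ^+ s * g) * 'C(m, s)%:R * f by ring.
rewrite !ler_wpM2r //.
apply: (@le_trans _ _ (N%:R ^+ s)); first by rewrite -natrX ler_nat ffact_leq_exp.
have e20 : 0 <= (2 / e) ^+ s by rewrite exprn_ge0 // divr_ge0 // ltW.
apply: le_trans (ler_wpM2l e20 low); rewrite -exprMn le_eqVlt; apply/orP; left.
by apply/eqP; congr (_ ^+ _); field; rewrite gt_eqF.
Qed.

(** For sparse [s], [L ^+ s] is at most [kappa ^+ s * (1 + kappa) ^+ m]; the binomial theorem gives
    the other [(1 + kappa) ^+ m]. *)
Lemma sum_bin_sparse (R : realType) (L kappa : R) (M m : nat) :
    0 <= L -> 0 <= kappa -> L <= kappa * (1 + kappa) ^+ M ->
  \sum_(s < m.+1 | (M * s <= m)%N) 'C(m, s)%:R * L ^+ s <= (1 + kappa) ^+ (2 * m).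
Proof.
move=> L0 k0 leL.
have k1 : 1 <= 1 + kappa by rewrite lerDl.
rewrite mul2n -addnn exprD [X in _ <= X * _]exprDn mulr_suml.
rewrite big_mkcond; apply: ler_sum => s _; rewrite expr1n mul1r.
case: ifP => [leMs|_]; last first.
  by rewrite mulr_ge0 ?mulrn_wge0 ?exprn_ge0 // ?(le_trans ler01).
rewrite -[kappa ^+ s *+ _]mulr_natl -mulrA ler_wpM2l //.
apply: (@le_trans _ _ ((kappa * (1 + kappa) ^+ M) ^+ s)).
  by rewrite lerXn2r // nnegrE ?(le_trans L0).
by rewrite exprMn -exprM ler_wpM2l ?exprn_ge0 // ler_weXn2l.
Qed.

(** * Counting by fingerprints *)

(** [J] is the union of some [h] elements of [J :\: A] and its remaining [l] elements. *)
Lemma card_split_subsets (V : finType) (X A : {set V}) (h l : nat) :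
  (#|[set J : {set V} | [&& J \subset X, #|J| == h + l & h <= #|J :\: A|]]|
     <= 'C(#|X :\: A|, h) * 'C(#|V|, l))%N.
Proof.
rewrite -cards_draws -card_draws -cardsX.
set P := setX _ _; pose u (q : {set V} * {set V}) := q.1 :|: q.2.
apply: leq_trans (leq_imset_card u (mem P)); apply: subset_leq_card.
apply/subsetP => J; rewrite inE => /and3P[JX /eqP cardJ hJ].
have [Y] : exists Y, Y \in [set Y : {set V} | Y \subset J :\: A & #|Y| == h].
  by apply/set0Pn; rewrite -card_gt0 cards_draws bin_gt0.
rewrite inE => /andP[YJA /eqP cardY].
have YJ : Y \subset J := subset_trans YJA (subsetDl _ _).
apply/imsetP; exists (Y, J :\: Y); last first.
  by rewrite /u /= -{1}(setID J Y) (setIidPr YJ).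
rewrite !inE /= cardY eqxx andbT (subset_trans YJA (setSD _ JX)) /=.
by rewrite cardsD (setIidPr YJ) cardJ cardY addKn.
Qed.

Lemma card_setD_image (V : finType) (S : {set V}) (F T : {set {set V}}) :
  (forall I, I \in F -> S \subset I /\ I :\: S \in T) -> (#|F| <= #|T|)%N.
Proof.
move=> FT; rewrite -(@card_in_imset _ _ (fun I => I :\: S) (mem F)).
  apply: subset_leq_card; apply/subsetP => _ /imsetP[I IF ->].
  by have [] := FT I IF.
move=> I J /FT[SI _] /FT[SJ _] eqD.
by rewrite -(setID I S) -(setID J S) (setIidPr SI) (setIidPr SJ) eqD.
Qed.

Definition unionf (V : finType) (t : nat) (phi : {ffun 'I_t -> {set V}}) :=
  \bigcup_i phi i.

Lemma card_unionf (V : finType) (t s : nat) :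
  (#|[set phi : {ffun 'I_t -> {set V}} | #|unionf phi| == s]|
     <= 'C(#|V|, s) * 2 ^ (t * s))%N.
Proof.
have card_eq (S : {set V}) : #|S| = s ->
    (#|[set phi : {ffun 'I_t -> {set V}} | unionf phi == S]| <= 2 ^ (t * s))%N.
  move=> cardS; rewrite mulnC expnM -cardS -card_powerset -[t in leqRHS]card_ord.
  rewrite -card_ffun_on; apply: subset_leq_card; apply/subsetP => phi.
  rewrite inE => /eqP<-; apply/ffun_onP => i; rewrite powersetE.
  exact: bigcup_sup.
rewrite -sum1_card (partition_big (@unionf V t) (fun S => #|S| == s)) /=; last first.
  by move=> phi; rewrite inE.
rewrite -card_draws -sum_nat_const.
under [leqRHS]eq_bigl do rewrite inE.
apply: leq_sum => S /eqP cardS.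
apply: leq_trans (card_eq S cardS); rewrite -sum1_card big_mkcond [leqRHS]big_mkcond.
apply: leq_sum => phi _; rewrite !inE; case: (_ == S); rewrite ?andbF ?andbT //.
by case: ifP.
Qed.

(** A union bound over the fingerprints, grouped by the size of their union. [Q] may be any
    relation: counting a set several times is harmless. *)
Lemma card_fingerprinted (R : realType) (V : finType) (t M m : nat) (g : nat -> R)
    (F : {set {set V}}) (Q : {ffun 'I_t -> {set V}} -> pred {set V}) :
    (0 < M)%N -> (forall s, (s <= m)%N -> 0 <= g s) ->
    (forall I, I \in F -> exists phi, Q phi I) ->
    (forall phi I, I \in F -> Q phi I -> (M * #|unionf phi| <= m)%N) ->
    (forall phi, (M * #|unionf phi| <= m)%N ->
       #|[set I in F | Q phi I]|%:R <= g #|unionf phi|) ->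
  #|F|%:R <= \sum_(s < m.+1 | (M * s <= m)%N)
               ('C(#|V|, s) * 2 ^ (t * s))%:R * g s.
Proof.
move=> M0 g0 exQ sparse le_g.
have leF : (#|F| <= \sum_phi #|[set I in F | Q phi I]|)%N.
  rewrite -sum1_card (eq_bigr (fun phi => \sum_(I in F) Q phi I)%N); last first.
    move=> phi _; rewrite -sum1_card big_mkcond [RHS]big_mkcond.
    by apply: eq_bigr => I _; rewrite inE; case: (I \in F); case: (Q phi I).
  rewrite exchange_big /=; apply: leq_sum => I IF; have [phi QI] := exQ I IF.
  by rewrite (bigD1 phi) //= QI.
apply: (@le_trans _ _ (\sum_(phi : {ffun 'I_t -> {set V}}
    | (M * #|unionf phi| <= m)%N) g #|unionf phi|)).
  apply: (@le_trans _ _ (\sum_phi #|[set I in F | Q phi I]|)%N%:R).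
    by rewrite ler_nat.
  rewrite natr_sum [leRHS]big_mkcond; apply: ler_sum => phi _.
  case: ifPn => [/le_g//|nsparse]; rewrite (_ : [set I in F | _] = set0) ?cards0 //.
  apply/setP => I; rewrite !inE; apply: contraNF nsparse => /andP[IF QI].
  exact: sparse QI.
(* This keeps [inord] below away from its default value. *)
have sm s : (M * s <= m)%N -> (s < m.+1)%N by rewrite ltnS; nia.
rewrite (partition_big (fun phi => inord #|unionf phi| : 'I_m.+1)
           (fun s : 'I_m.+1 => (M * s <= m)%N)) /=; last first.
  by move=> phi leM; rewrite inordK // sm.
apply: ler_sum => s leMs.
rewrite (eq_bigr (fun=> g s)); last first.
  by move=> phi /andP[leM /eqP<-]; rewrite inordK // sm.
rewrite sumr_const -[g s *+ _]mulr_natl ler_wpM2r ?g0 //; first by rewrite -ltnS.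
rewrite ler_nat.
apply: leq_trans (card_unionf V t s); apply: subset_leq_card.
apply/subsetP => phi; rewrite !inE => /andP[leM /eqP<-].
by rewrite inordK // sm.
Qed.

(** * Counting with stability *)

Definition stable_container (R : realType) (V : finType) (a e d : R)
    (B : {set {set V}}) (X : {set V}) :=
  #|X|%:R < (a - e) * #|V|%:R \/
  exists2 A, A \in B & #|X :\: A|%:R <= d * #|V|%:R.

Lemma card_far_le (R : realType) (V : finType) (S X A I : {set V}) (delta : R) :
    S \subset I -> I :\: S \subset X -> 2 * #|S|%:R <= delta * #|I|%:R ->
    delta * #|I|%:R <= #|I :\: A|%:R ->
  delta * #|I|%:R / 2 <= #|(I :\: S) :\: A|%:R
  /\ delta * #|I|%:R / 2 <= #|X :\: A|%:R.
Proof.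
move=> SI IX leS leI.
have le1 : (#|I :\: A| <= #|S| + #|(I :\: S) :\: A|)%N.
  apply: leq_trans (leq_card_setU _ _); apply: subset_leq_card.
  by apply/subsetP => v; rewrite !inE => /andP[-> ->]; case: (v \in S).
have le2 : (#|(I :\: S) :\: A| <= #|X :\: A|)%N.
  by rewrite subset_leq_card // setSD.
move: le1 le2; rewrite -!(ler_nat R) natrD; split; lra.
Qed.

Lemma card_fiber_le (R : realType) (V : finType) (a e delta d : R) (m M : nat)
    (B F : {set {set V}}) (S X : {set V}) :
    0 < a < 1 -> 0 < e <= a / 2 -> 0 < delta -> 2 <= delta * M%:R ->
    d <= (a / 8) ^+ M -> d <= delta * a / 4 ->
    m%:R <= (a - e / 2) * #|V|%:R -> 2 * #|S|%:R <= delta * m%:R ->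
    stable_container a e d B X ->
    (forall I, I \in F -> [/\ #|I| = m, S \subset I, I :\: S \subset X
       & forall A, A \in B -> delta * m%:R <= #|I :\: A|%:R]) ->
  #|F|%:R <= (1 - e) ^+ (m - #|S|) * rbinom (a * #|V|%:R) (m - #|S|).
Proof.
move=> /andP[a0 a1] /andP[e0 ea] delta0 leM led1 led2 lem leS stabX FP.
set j := (m - #|S|)%N; have N0 : 0 <= #|V|%:R :> R by [].
have eN : 0 <= e * #|V|%:R by rewrite mulr_ge0 // ltW.
have lejm : j%:R <= m%:R :> R by rewrite ler_nat leq_subr.
have lejx : j%:R <= a * #|V|%:R by lra.
have e1 : 0 <= 1 - e <= 1 by lra.
have rb0 := rbinom_ge0 lejx.
have [->|[I0 I0F]] := set_0Vmem F.
  by rewrite cards0 mulr_ge0 // exprn_ge0; case/andP: e1.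
case: stabX => [ltX|[A AB leXA]].
  apply: (@le_trans _ _ ('C(#|X|, j))%:R).
    rewrite ler_nat -cards_draws; apply: (@card_setD_image _ S) => I IF.
    have [cardI SI IX _] := FP I IF; split=> //.
    by rewrite inE IX cardsD (setIidPr SI) cardI eqxx.
  apply: (@bin_le_shrunk_rbinom _ _ #|V|%:R a) => //; lra.
have [cardI0 SI0 I0X /(_ A AB) farI0] := FP I0 I0F.
rewrite -cardI0 in farI0 leS.
have [_ leXd] := card_far_le SI0 I0X leS farI0.
(* A single member of [F] leaves [delta * m / 2] vertices of [X] outside [A], and there are at most
   [d * #|V|] of those. *)
have lem2 : m%:R <= a * #|V|%:R / 2.
  have : d * #|V|%:R <= delta * a / 4 * #|V|%:R by rewrite ler_wpM2r.
  have := le_trans leXd leXA; rewrite cardI0 => h1 h2.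
  rewrite -(ler_pM2l delta0); lra.
have M0 : (0 < M)%N by case: M leM led1 => // ; rewrite mulr0; lra.
(* [h] is [m / M] rounded up; since [2 <= delta * M], each set to be counted keeps that many
   elements outside [A]. *)
have exh : exists z, (m <= M * z)%N by exists m; apply: leq_pmull.
case: (ex_minnP exh) => h hM h_min.
have h_le I : I \in F -> (h <= #|(I :\: S) :\: A|)%N.
  move=> IF; have [cardI SI IX /(_ A AB) farI] := FP I IF.
  rewrite -cardI in farI; rewrite cardI0 -cardI in leS.
  have [le1 _] := card_far_le SI IX leS farI.
  apply: h_min; rewrite -(ler_nat R) natrM.
  have := ler_wpM2r (ler0n R m) leM; rewrite -cardI => le2.
  have := ler_wpM2l (ler0n R M) le1; lra.
have hj : (h <= j)%N.
  apply: leq_trans (h_le _ I0F) _; apply: leq_trans (subset_leq_card (subsetDl _ _)) _.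
  by rewrite cardsD (setIidPr SI0) cardI0.
(* Here [2^-1 <= 1 - e] because [e <= a / 2 < 1 / 2]. *)
apply: (@le_trans _ _ (2^-1 ^+ m * rbinom (a * #|V|%:R) j)); last first.
  rewrite ler_wpM2r //; apply: (@le_trans _ _ (2^-1 ^+ j)).
    by rewrite ler_wiXn2l ?leq_subr //; lra.
  by rewrite lerXn2r // ?nnegrE; lra.
apply: (@le_trans _ _ ('C(#|X :\: A|, h) * 'C(#|V|, j - h))%:R).
  rewrite ler_nat; apply: leq_trans (card_split_subsets _ _ _ _).
  apply: (@card_setD_image _ S) => I IF.
  have [cardI SI IX _] := FP I IF; split=> //.
  by rewrite inE IX h_le // cardsD (setIidPr SI) cardI subnKC // eqxx.
rewrite -[in leRHS](subnKC hj).
apply: (@bin_mul_le_rbinom _ _ _ _ _ _ _ M) => //; first lra.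
- by apply: le_trans leXA _; rewrite ler_wpM2r.
- by rewrite subnKC // leq_subr.
Qed.

Lemma card_fingerprinted_le (R : realType) (V : finType) (a e delta d : R)
    (t m M M' : nat) (B F : {set {set V}})
    (X : {ffun 'I_t -> {set V}} -> {set V}) (Q : {ffun 'I_t -> {set V}} -> pred {set V}) :
    0 < a < 1 -> 0 < e <= a / 2 -> 0 < delta -> 2 <= delta * M'%:R ->
    d <= (a / 8) ^+ M' -> d <= delta * a / 4 ->
    2 <= delta * M%:R -> 2 <= e * M%:R ->
    2 ^+ t * (2 / e) / (1 - e) <= e / 4 * (1 + e / 4) ^+ M ->
    (0 < #|V|)%N ->
    (forall I, I \in F -> #|I| = m
       /\ forall A, A \in B -> delta * m%:R <= #|I :\: A|%:R) ->
    (forall I, I \in F -> exists phi, Q phi I) ->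
    (forall phi I, I \in F -> Q phi I ->
       [/\ unionf phi \subset I, (M * #|unionf phi| <= m)%N,
           I :\: unionf phi \subset X phi & stable_container a e d B (X phi)]) ->
  #|F|%:R <= (1 - e / 4) ^+ m * Num.max 0 (rbinom (a * #|V|%:R) m).
Proof.
move=> a01 e0a delta0 leM' led1 led2 leMd leMe leL V0 FP exQ QP.
have [a0 a1] := andP a01; have [e0 ea] := andP e0a.
have NR : 0 < #|V|%:R :> R by rewrite ltr0n.
have e4 : 0 <= 1 - e / 4 by lra.
have [->|[I0 I0F]] := set_0Vmem F.
  by rewrite cards0 mulr_ge0 ?exprn_ge0 // le_max lexx.
have M0 : (0 < M)%N by case: (M) leMe => //; rewrite mulr0; lra.
have small s : (M * s <= m)%N -> 2 * s%:R <= delta * m%:R /\ 2 * s%:R <= e * m%:R :> R.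
  rewrite -(ler_nat R) natrM => Ms; split.
    have := ler_wpM2l (ltW delta0) Ms; have := ler_wpM2r (ler0n R s) leMd; lra.
  have := ler_wpM2l (ltW e0) Ms; have := ler_wpM2r (ler0n R s) leMe; lra.
(* One member of [F] forces [m] below [a * #|V|] with room to spare, so [Num.max] selects the
   binomial and [bin_mul_rbinom_le] applies. *)
have lem : m%:R <= (a - e / 2) * #|V|%:R.
  have [cardI far] := FP _ I0F; have [phi QI] := exQ _ I0F.
  have [SI /small[leSd leSe] IX] := QP _ _ I0F QI.
  have eN := mulr_gt0 e0 NR; have aN := mulr_gt0 a0 NR.
  case=> [ltX|[A AB leXA]].
    have mN : m%:R <= #|V|%:R :> R by rewrite ler_nat -cardI max_card.
    have emN : e * m%:R <= e * #|V|%:R by rewrite ler_wpM2l // ltW.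
    have : (m <= #|unionf phi| + #|X phi|)%N.
      rewrite -cardI -(cardsID (unionf phi) I0) leq_add ?subset_leq_card //.
      exact: subsetIr.
    rewrite -(ler_nat R) natrD; lra.
  have far0 := far _ AB; rewrite -cardI in far0 leSd.
  have [_ le1] := card_far_le SI IX leSd far0; rewrite cardI in le1.
  have : d * #|V|%:R <= delta * a / 4 * #|V|%:R by rewrite ler_wpM2r.
  move=> le2; have ltm : m%:R <= a * #|V|%:R / 2 by rewrite -(ler_pM2l delta0); lra.
  have : e * #|V|%:R <= a / 2 * #|V|%:R by rewrite ler_wpM2r.
  lra.
have lemx : m%:R <= a * #|V|%:R by have := mulr_gt0 e0 NR; lra.
rewrite (max_idPr (rbinom_ge0 lemx)).
have rb0 := rbinom_ge0 lemx.
pose g s := (1 - e) ^+ (m - s) * rbinom (a * #|V|%:R) (m - s).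
have e1 : 0 < 1 - e by lra.
have g0 s : (s <= m)%N -> 0 <= g s.
  move=> sm; rewrite mulr_ge0 ?exprn_ge0 ?rbinom_ge0 //; first exact: ltW.
  by apply: le_trans lemx; rewrite ler_nat leq_subr.
apply: (le_trans (@card_fingerprinted R V t M m g F Q M0 g0 exQ _ _)).
- by move=> phi I IF QI; have [] := QP phi I IF QI.
- move=> phi Mphi; have [leSd leSe] := small _ Mphi.
  have [->|[I1]] := set_0Vmem [set I in F | Q phi I].
    by rewrite cards0 g0 // (leq_trans _ Mphi) // leq_pmull.
  rewrite inE => /andP[I1F QI1].
  have [_ _ _ stabX] := QP _ _ I1F QI1.
  apply: (card_fiber_le a01 e0a delta0 leM' led1 led2 lem leSd stabX) => I.
  rewrite inE => /andP[IF QI]; have [cardI far] := FP _ IF.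
  by have [SI _ IX _] := QP _ _ IF QI.
(* The price per element of the fingerprint: [2 ^+ t] for its distribution among the [t] sets,
   [2 / e] for the change of binomial, [(1 - e)^-1] for the exponent [m - s] in place of [m]. *)
set L := 2 ^+ t * (2 / e) / (1 - e) in leL.
have L0 : 0 <= L by rewrite /L !mulr_ge0 ?exprn_ge0 ?invr_ge0 // ltW.
have k0 : 0 <= e / 4 by lra.
apply: (@le_trans _ _ ((1 - e) ^+ m * rbinom (a * #|V|%:R) m
   * \sum_(s < m.+1 | (M * s <= m)%N) 'C(m, s)%:R * L ^+ s)).
  rewrite mulr_sumr; apply: ler_sum => s _.
  have sm : (s <= m)%N by rewrite -ltnS.
  have := @bin_mul_rbinom_le R (a * #|V|%:R) e #|V| (m - s) s e0 V0.
  rewrite subnK // => /(_ _) le1.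
  have {le1} : 'C(#|V|, s)%:R * rbinom (a * #|V|%:R) (m - s)
      <= 'C(m, s)%:R * (2 / e) ^+ s * rbinom (a * #|V|%:R) m by apply: le1; lra.
  have w0 : 0 <= (2 ^+ t) ^+ s * (1 - e) ^+ (m - s).
    by rewrite mulr_ge0 ?exprn_ge0 // ltW.
  move=> /(ler_wpM2l w0) le2; apply: le_trans (le_trans _ le2) _.
    by rewrite /g natrM natrX exprM le_eqVlt; apply/orP; left; apply/eqP; ring.
  have -> : (1 - e) ^+ m = (1 - e) ^+ (m - s) * (1 - e) ^+ s.
    by rewrite -exprD subnK.
  have -> : (2 ^+ t) ^+ s = L ^+ s * (1 - e) ^+ s / (2 / e) ^+ s.
    rewrite -exprMn -exprVn -exprMn; congr (_ ^+ _); rewrite /L; field.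
    by rewrite !gt_eqF.
  rewrite le_eqVlt; apply/orP; left; apply/eqP; field.
  by rewrite expf_neq0 ?mulf_neq0 ?invr_neq0 ?gt_eqF.
have := sum_bin_sparse m L0 k0 leL.
move/(ler_wpM2l (mulr_ge0 (exprn_ge0 m (ltW e1)) rb0)) => le1.
apply: le_trans le1 _; rewrite mulrAC ler_wpM2r //.
(* What remains is [(1 - e) * (1 + e / 4) ^+ 2 <= 1 - e / 4]. *)
rewrite exprM -exprMn lerXn2r ?nnegrE //; first by rewrite mulr_ge0 ?sqr_ge0 ?ltW.
have := mulr_gt0 e0 e0; have := mulr_ge0 (mulr_ge0 (ltW e0) (ltW e0)) (ltW e0).
rewrite expr2; nra.
Qed.

(** * Fingerprints as finite functions, and the choice of constants *)

Lemma unionf_codom (V : finType) (t : nat) (phi : {ffun 'I_t -> {set V}}) :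
  unions (codom phi) = unionf phi.
Proof. by rewrite /unions /codom big_image. Qed.

Lemma seq_codom (V : finType) (tau : seq {set V}) :
  exists phi : {ffun 'I_(size tau) -> {set V}}, codom phi = tau.
Proof.
exists [ffun i : 'I_(size tau) => nth set0 tau i].
rewrite -[RHS](mkseq_nth set0) /mkseq -val_enum_ord -map_comp codomE.
by apply: eq_map => i; rewrite ffunE.
Qed.

Lemma card_unionf_le (V : finType) (t b : nat) (phi : {ffun 'I_t -> {set V}}) :
  (forall i, #|phi i| <= b)%N -> (#|unionf phi| <= t * b)%N.
Proof.
move=> leb; apply: (@leq_trans (\sum_(i < t) b)); last first.
  by rewrite sum_nat_const card_ord.
rewrite /unionf; elim/big_ind2: _ => [|A x B' y lex ley|i _].
- by rewrite cards0.
- by apply: leq_trans (leq_card_setU _ _) (leq_add lex ley).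
- exact: leb.
Qed.

(* Gives [1 <= c p N] when [2 <= k], so that rounding [p N] up is harmless. *)
Lemma size_le_maxdeg2 (H : hypergraph) :
    (forall A, A \in edges H -> 2 <= #|A|)%N ->
  (nedges H <= nverts H ^ 2 * maxdeg 2 H)%N.
Proof.
move=> ge2; apply: (@leq_trans (\sum_(T : {set vert H} | #|T| == 2%N) deg T)).
  rewrite sum_count /nedges -sum1_size big_seq [leqRHS]big_seq.
  apply: leq_sum => A /ge2 A2.
  rewrite (eq_card (B := [set T : {set vert H} | T \subset A & #|T| == 2%N])).
    by rewrite cards_draws bin_gt0.
  by move=> T; rewrite !inE andbC.
apply: (@leq_trans ('C(nverts H, 2) * maxdeg 2 H)).
  rewrite /nverts -card_draws -sum_nat_const.
  under [leqRHS]eq_bigl do rewrite inE.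
  by apply: leq_sum => T T2; apply: (@leq_bigmax_cond _ _ (@deg H)).
by rewrite leq_mul2r (leq_trans _ (ffact_leq_exp _ 2)) ?orbT // -bin_ffact leq_pmulr.
Qed.

Lemma exists_nat_ge (R : realType) (x : R) : exists n : nat, x <= n%:R.
Proof. by exists (Num.truncn x).+1; apply/ltW/truncnS_gt. Qed.

Lemma mulrn_le_exp1D (R : realType) (x : R) n : 0 <= x -> n%:R * x <= (1 + x) ^+ n.
Proof.
move=> x0; elim: n => [|n IHn]; first by rewrite mul0r expr0.
have : 1 <= (1 + x) ^+ n by rewrite exprn_ege1 // lerDl.
move/(ler_wpM2l x0); rewrite exprS mulrSr; lra.
Qed.

(** Sets larger than [k] lie in no edge, and the bound is monotone in [q]. *)
Lemma capped_hypergraph (R : realType) (k : nat) (c p q : R) (H : hypergraph) :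
    0 < c -> 0 <= p -> p <= q -> uniform k H ->
    (forall l, (1 <= l <= k)%N ->
       (maxdeg l H)%:R <= c * p ^+ (l - 1) * ((nedges H)%:R / (nverts H)%:R)) ->
  capped c q (edges H).
Proof.
move=> c0 p0 pq unif degH T T0; set l := #|T|.
have eN : 0 <= (nedges H)%:R / (nverts H)%:R :> R by rewrite divr_ge0.
have [lek|ltk] := leqP l k; last first.
  have -> : cdeg (edges H) T = 0%N.
    apply/eqP; rewrite -leqn0 leqNgt -has_count; apply/hasPn => A /(allP unif)/eqP A1.
    by apply/negP => /subset_leq_card; rewrite A1 leqNgt ltk.
  exact: mulr_ge0 (mulr_ge0 (ltW c0) (exprn_ge0 _ (le_trans p0 pq))) eN.
have l0 : (0 < l)%N by rewrite card_gt0.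
apply: (@le_trans _ _ (maxdeg l H)%:R).
  by rewrite ler_nat; apply: (@leq_bigmax_cond _ _ (@deg H)).
apply: (le_trans (degH l _)); first by rewrite l0.
by rewrite ler_wpM2r // ler_wpM2l ?(ltW c0) // lerXn2r ?nnegrE // (le_trans p0).
Qed.

Theorem theorem6p3 (R : realType) (k : nat) (alpha c : R)
    (H : nat -> hypergraph) (p : nat -> R)
    (B : forall n, {set {set vert (H n)}}) :
  0 < alpha < 1 ->
  0 < c ->
  (forall n, uniform k (H n)) ->
  (forall n, (0 < nedges (H n))%N) ->
  (forall n, 0 <= p n <= 1) ->
  (forall n l, (1 <= l <= k)%N ->
    (maxdeg l (H n))%:R
      <= c * p n ^+ (l - 1) * ((nedges (H n))%:R / (nverts (H n))%:R)) ->
  stable alpha B ->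
  forall delta : R, 0 < delta ->
  exists eps C : R, 0 < eps /\
  exists n0 : nat, forall n, (n0 <= n)%N ->
  forall m : nat, C * p n * (nverts (H n))%:R <= m%:R ->
    #|[set I in indep_sets (H n) m |
        [forall A in B n, delta * m%:R <= #|I :\: A|%:R]]|%:R
      <= (1 - eps) ^+ m
         * Num.max 0 (rbinom (alpha * (nverts (H n))%:R) m).
Proof.
move=> a01 c0 unifH H0 p01 degH stabH delta delta0.
(* For [k = 0] the empty set is an edge, so no set is independent. *)
case: k => [|r] in unifH degH *.
  exists 2^-1, 0; split; first by rewrite invr_gt0.
  exists 0%N => n _ m _; rewrite (_ : [set I in _ | _] = set0).
    by rewrite cards0 mulr_ge0 ?le_max ?lexx // exprn_ge0 //; lra.
  apply/setP => I; rewrite !inE; apply/negP => /andP[/andP[/allP indI _] _].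
  have := H0 n; rewrite -has_predT => /hasP[A AH _].
  have := allP (unifH n) _ AH; rewrite cards_eq0 => /eqP A0.
  by have := indI _ AH; rewrite A0 sub0set.
have [a0 a1] := andP a01.
have [M' leM'] := exists_nat_ge (2 / delta).
have {}leM' : 2 <= delta * M'%:R by rewrite mulrC -ler_pdivrMr.
pose d := Num.min ((alpha / 8) ^+ M') (delta * alpha / 4).
have d0 : 0 < d.
  by rewrite lt_min exprn_gt0 ?divr_gt0 // mulr_gt0.
have [e0 [n0 [e00 stab0]]] := stabH d d0.
pose e := Num.min e0 (alpha / 2).
have e_gt0 : 0 < e by rewrite lt_min e00 divr_gt0.
have ea : e <= alpha / 2 by rewrite ge_min lexx orbT.
have ee0 : e <= e0 by rewrite ge_min lexx.
have [nT cont] := containers r c0 e_gt0.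
pose t := (nT * r)%N.
pose L := 2 ^+ t * (2 / e) / (1 - e).
have L0 : 0 <= L.
  by rewrite !mulr_ge0 ?exprn_ge0 ?invr_ge0 ?subr_ge0 ?(ltW e_gt0) //; lra.
(* Each summand serves one requirement on [M]; the last one combines with [mulrn_le_exp1D] at
   [e / 4]. *)
have [M leM] := exists_nat_ge (2 / delta + 2 / e + L / (e / 4) ^+ 2).
have k0 : 0 < e / 4 by rewrite divr_gt0.
have u1 : 0 <= 2 / delta by rewrite divr_ge0 // ltW.
have u2 : 0 <= 2 / e by rewrite divr_ge0 // ltW.
have u3 : 0 <= L / (e / 4) ^+ 2 by rewrite divr_ge0 // sqr_ge0.
have leMd : 2 <= delta * M%:R by rewrite mulrC -ler_pdivrMr //; lra.
have leMe : 2 <= e * M%:R by rewrite mulrC -ler_pdivrMr //; lra.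
have leML : L <= e / 4 * (1 + e / 4) ^+ M.
  apply: le_trans (ler_wpM2l (ltW k0) (mulrn_le_exp1D M (ltW k0))).
  by rewrite mulrCA -expr2 -ler_pdivrMr ?exprn_gt0 //; lra.
(* A fingerprint has at most [t * b] elements, and [b] is at most [(1 + c) * p n * #|V|] unless
   [t = 0]; this [C] makes [M] times that size at most [m]. *)
exists (e / 4), (M%:R * (t%:R * (1 + c))); split=> //.
exists n0 => n n0n m lem.
set V := vert (H n); set G := edges (H n).
have cardG A : A \in G -> #|A| = r.+1 by move/(allP (unifH n))/eqP.
have V0 : (0 < #|V|)%N := uniform_verts (H0 n) cardG.
have NR : 0 < #|V|%:R :> R by rewrite ltr0n.
have [p0 p1] := andP (p01 n).
pose b := (Num.truncn (p n * #|V|%:R)).+1.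
have pN0 : 0 <= p n * #|V|%:R by rewrite mulr_ge0.
have leb : b%:R <= p n * #|V|%:R + 1.
  by rewrite /b -addn1 natrD lerD2r truncn_le.
(* For [r = 0] also [t = 0]. Otherwise pair degrees give [1 <= c * (p n * #|V|)]. *)
have tb : t%:R * b%:R <= t%:R * (1 + c) * (p n * #|V|%:R).
  case: r @t @L {degH cont L0 leM u3 leML lem} unifH (degH n 2%N) cardG => [|r] t L _ deg2 cardG.
    by rewrite /t muln0 !mul0r.
  rewrite -mulrA ler_wpM2l //; apply: le_trans leb _.
  have := @size_le_maxdeg2 (H n); rewrite -(ler_nat R) natrM natrX => /(_ _) leG.
  have {leG} : (nedges (H n))%:R <= #|V|%:R ^+ 2 * (maxdeg 2 (H n))%:R :> R.
    by apply: leG => A /cardG->.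
  move=> leG; have {}deg2 := deg2 isT; rewrite subSS subn0 expr1 in deg2.
  have eR : 0 < (nedges (H n))%:R :> R by rewrite ltr0n.
  have := le_trans leG (ler_wpM2l (sqr_ge0 _) deg2).
  have -> : #|V|%:R ^+ 2 * (c * p n * ((nedges (H n))%:R / (nverts (H n))%:R))
      = c * (p n * #|V|%:R) * (nedges (H n))%:R.
    by rewrite /nverts -/V; field; rewrite gt_eqF.
  rewrite -[leLHS]mul1r ler_pM2r // => ?; lra.
have capG : capped c (b%:R / #|V|%:R) G.
  apply: (@capped_hypergraph _ r.+1 _ (p n)) => //; last exact: degH.
  by rewrite ler_pdivlMr // ltW // truncnS_gt.
have [f fP] := cont V b G cardG (H0 n) capG.
pose Q (phi : {ffun 'I_t -> {set V}}) (I : {set V}) :=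
  [&& all (fun S : {set V} => (S \subset I) && (#|S| <= b)%N) (codom phi),
      I :\: unionf phi \subset f (codom phi)
    & (count (fun A : {set V} => A \subset f (codom phi)) G)%:R < e * (size G)%:R].
apply: (@card_fingerprinted_le R V alpha e delta d t m M M' (B n) _
          (fun phi => f (codom phi)) Q) => //.
- by rewrite e_gt0.
- by rewrite ge_min lexx.
- by rewrite ge_min lexx orbT.
- move=> I; rewrite !inE => /andP[/andP[_ /eqP cardI] /forallP far]; split=> // A AB.
  by have := far A; rewrite AB.
- move=> I; rewrite !inE => /andP[/andP[indI _] _].
  have [tau [sztau subtau sepI ltc]] := fP I indI.
  have [phi phiE] := seq_codom tau; move: phi phiE; rewrite sztau => phi phiE.
  by exists phi; rewrite /Q -unionf_codom phiE subtau ltc -[I in I :\: _]setIT sepI.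
- move=> phi I _ /and3P[/allP subphi sepI ltc].
  have sub i : (phi i \subset I) && (#|phi i| <= b)%N by apply/subphi/codom_f.
  split=> //.
  + by apply/bigcupsP => i _; have /andP[] := sub i.
  + have : (#|unionf phi| <= t * b)%N.
      by apply: card_unionf_le => i; have /andP[] := sub i.
    rewrite -!(ler_nat R) [(t * b)%:R]natrM [(M * _)%:R]natrM => /(ler_wpM2l (ler0n R M)) le1.
    apply: le_trans le1 (le_trans (ler_wpM2l (ler0n R M) tb) _).
    by apply: le_trans lem; rewrite !mulrA.
  (* A container that is not small falls under stability, whose first alternative contradicts its
     sparsity since [e <= e0]. *)
  + have [|leX] := ltP #|f (codom phi)|%:R ((alpha - e) * #|V|%:R); first by left.
    right; case: (stab0 n n0n (f (codom phi))) => [|le1|//].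
      by apply: le_trans leX; rewrite ler_wpM2r // lerB.
    exfalso; move: ltc; rewrite ltNge => /negP[]; move: le1.
    rewrite /nedges size_map size_filter; apply: le_trans.
    by rewrite ler_wpM2r.
Qed.
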